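(* Let $\mathcal{A}_d:Q\times Q\to G$ be a map satisfying $\mathcal{A}_d(gq_0,gq_1)=g\,\mathcal{A}_d(q_0,q_1)\,g^{-1}$ for all $g\in G$, $q_0,q_1\in Q$, and $\mathcal{A}_d(q,gq)=g$ for all $q\in Q$, $g\in G$. Define $$\operatorname{hor}(q_0,q_1)=i_{q_0}\big((\mathcal{A}_d(q_0,q_1))^{-1}\big)\cdot(q_0,q_1),\qquad \operatorname{ver}(q_0,q_1)=i_{q_0}(\mathcal{A}_d(q_0,q_1)).$$ Then: 1. $(q_0,q_1)=\operatorname{ver}(q_0,q_1)\cdot\operatorname{hor}(q_0,q_1)$ for all $(q_0,q_1)\in Q\times Q$; 2. $\operatorname{hor}(gq_0,gq_1)=g\cdot\operatorname{hor}(q_0,q_1)$ and $\operatorname{ver}(gq_0,gq_1)=g\cdot\operatorname{ver}(q_0,q_1)$ for all $g\in G$ and $q_0,q_1\in Q$.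
   Context: $Q$ is a smooth manifold with a free smooth left action $(g,q)\mapsto gq$ of a Lie group $G$ such that the projection $\pi:Q\to S=Q/G$ is a submersion. $G$ acts on $Q\times Q$ diagonally, $g\cdot(q_0,q_1)=(gq_0,gq_1)$. The discrete generator is $i_q(g)=(q,gq)$; elements of this form are called vertical. The composition of a vertical element with an arbitrary element is $i_{q_0}(g)\cdot(q_0,q_1)=(q_0,gq_1)$. *)

(* Defs.v *)
From HB Require Import structures.
From mathcomp Require Import all_boot all_order all_algebra.
From mathcomp Require Import all_classical all_reals topology normedtype derive.

Set Implicit Arguments.
Unset Strict Implicit.
Unset Printing Implicit Defensive.

Import numFieldNormedType.Exports.

Local Open Scope classical_set_scope.
Local Open Scope ring_scope.
Local Open Scope quotient_scope.

(* For [U] open. All iterated directional derivatives up to order [k] exist on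
   [U] and those of order [k] are continuous there; the quotients by which
   ['D_v f x] is defined only see [f] near [x], so values off [U] are
   irrelevant. *)
Fixpoint Ck (R : realType) (V W : normedModType R) (k : nat) (U : set V)
    (f : V -> W) : Prop :=
  if k is k'.+1 then
    forall v, (forall x, U x -> derivable f x v) /\ Ck k' U ('D_v f)
  else forall x, U x -> {for x, continuous f}.

Definition smooth_on (R : realType) (V W : normedModType R) (U : set V)
    (f : V -> W) : Prop :=
  forall k, Ck k U f.

(* [chart_map] is meaningful on [chart_dom] only, and [chart_inv] on its
   image. *)
Record chart (R : realType) (n : nat) (T : Type) := Chart {
  chart_dom : set T;
  chart_map :> T -> 'rV[R]_n;
  chart_inv : 'rV[R]_n -> T
}.

Definition chart_image (R : realType) (n : nat) (T : Type) (c : chart R n T) :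
  set 'rV[R]_n := c @` chart_dom c.

Definition is_chart (R : realType) (n : nat) (T : topologicalType)
    (c : chart R n T) : Prop :=
  [/\ open (chart_dom c),
      open (chart_image c),
      forall x, chart_dom c x -> chart_inv c (c x) = x,
      forall x, chart_dom c x -> {for x, continuous c} &
      forall y, chart_image c y -> {for y, continuous (chart_inv c)}].

Definition local_rep (R : realType) (m n : nat) (M N : Type) (c : chart R m M)
    (d : chart R n N) (f : M -> N) : 'rV[R]_m -> 'rV[R]_n :=
  fun y => d (f (chart_inv c y)).

Definition local_rep_dom (R : realType) (m n : nat) (M N : Type)
    (c : chart R m M) (d : chart R n N) (f : M -> N) : set 'rV[R]_m :=
  c @` (chart_dom c `&` f @^-1` chart_dom d).

(* The atlas need not be maximal: smoothness only depends on the maximal atlas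
   it generates. *)
Definition is_smooth_atlas (R : realType) (n : nat) (T : topologicalType)
    (A : set (chart R n T)) : Prop :=
  [/\ hausdorff_space T,
      @second_countable T,
      forall c, A c -> is_chart c,
      forall x : T, exists2 c, A c & chart_dom c x &
      forall c d, A c -> A d ->
        smooth_on (local_rep_dom c d idfun) (local_rep c d idfun)].

Definition smooth_map (R : realType) (m n : nat) (M N : topologicalType)
    (A : set (chart R m M)) (B : set (chart R n N)) (f : M -> N) : Prop :=
  continuous f /\
  forall c d, A c -> B d -> smooth_on (local_rep_dom c d f) (local_rep c d f).

Definition submersion (R : realType) (m n : nat) (M N : topologicalType)
    (A : set (chart R m M)) (B : set (chart R n N)) (f : M -> N) : Prop :=
  smooth_map A B f /\
  forall c d x, A c -> B d -> chart_dom c x -> chart_dom d (f x) ->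
    range ('d (local_rep c d f) (c x)) = setT.

Definition prod_chart (R : realType) (m n : nat) (M N : Type)
    (c : chart R m M) (d : chart R n N) : chart R (m + n) (M * N)%type :=
  Chart (chart_dom c `*` chart_dom d)
        (fun p => row_mx (c p.1) (d p.2))
        (fun y => (chart_inv c (lsubmx y), chart_inv d (rsubmx y))).

Definition prod_atlas (R : realType) (m n : nat) (M N : Type)
    (A : set (chart R m M)) (B : set (chart R n N)) :
    set (chart R (m + n) (M * N)%type) :=
  [set e | exists c d, [/\ A c, B d & e = prod_chart c d]].

HB.mixin Record isSmoothManifold (R : realType) (n : nat) T
    of Topological T := {
  atlas : set (chart R n T);
  atlasP : is_smooth_atlas atlas
}.

#[short(type="smoothManifoldType")]
HB.structure Definition SmoothManifold (R : realType) (n : nat) :=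
  {T of Topological T & isSmoothManifold R n T}.

Arguments atlas {R n} s.

#[short(type="groupManifoldType")]
HB.structure Definition GroupManifold (R : realType) (n : nat) :=
  {T of SmoothManifold R n T & Group T}.

HB.mixin Record isLieGroup (R : realType) (n : nat) T
    of GroupManifold R n T := {
  mulg_smooth : smooth_map (prod_atlas (atlas T) (atlas T)) (atlas T)
                  (fun p : T * T => (p.1 * p.2)%g);
  invg_smooth : smooth_map (atlas T) (atlas T) (fun x : T => (x^-1)%g)
}.

#[short(type="lieGroupType")]
HB.structure Definition LieGroup (R : realType) (n : nat) :=
  {T of GroupManifold R n T & isLieGroup R n T}.

Record left_action (G : groupType) (T : Type) := LeftAction {
  act :> G -> T -> T;
  act1 : forall x, act 1%g x = x;
  actM : forall g h x, act (g * h)%g x = act g (act h x)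
}.

Definition free_action (G : groupType) (T : Type) (a : left_action G T) :
  Prop :=
  forall g x, a g x = x -> g = 1%g.

Definition smooth_action (R : realType) (m n : nat) (G : lieGroupType R m)
    (Q : smoothManifoldType R n) (a : left_action G Q) : Prop :=
  smooth_map (prod_atlas (atlas G) (atlas Q)) (atlas Q)
    (fun p : G * Q => a p.1 p.2).

Section Orbits.
Context (G : groupType) (Q : topologicalType) (a : left_action G Q).

Definition same_orbit : rel Q := fun x y => `[< exists g, y = a g x >].

Fact same_orbit_refl : reflexive same_orbit.
Proof. by move=> x; apply/asboolP; exists 1%g; rewrite act1. Qed.

Fact same_orbit_sym : symmetric same_orbit.
Proof.
have H x y : same_orbit x y -> same_orbit y x.
  move=> /asboolP[g ->]; apply/asboolP; exists (g^-1)%g.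
  by rewrite -actM mulVg act1.
by move=> x y; apply/idP/idP; exact: H.
Qed.

Fact same_orbit_trans : transitive same_orbit.
Proof.
move=> y x z /asboolP[g ->] /asboolP[h ->]; apply/asboolP.
by exists (h * g)%g; rewrite actM.
Qed.

Canonical same_orbit_equiv :=
  EquivRel same_orbit same_orbit_refl same_orbit_sym same_orbit_trans.

Definition orbit_space : topologicalType :=
  quotient_topology {eq_quot same_orbit_equiv}.

Definition orbit_proj : Q -> orbit_space := \pi_{eq_quot same_orbit_equiv}.

End Orbits.

(* [Q / G], with its quotient topology, carries a smooth structure for which
   the projection is a submersion. *)
Definition proj_submersion (R : realType) (n : nat) (G : groupType)
    (Q : smoothManifoldType R n) (a : left_action G Q) : Prop :=
  exists (s : nat) (B : set (chart R s (orbit_space a))),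
    is_smooth_atlas B /\ submersion (atlas Q) B (orbit_proj a).

Section DiscreteConnection.
Context (G : groupType) (Q : Type) (a : left_action G Q).

Fact diag_act1 (p : Q * Q) : (a 1%g p.1, a 1%g p.2) = p.
Proof. by rewrite !act1; case: p. Qed.

Fact diag_actM g h (p : Q * Q) :
  (a (g * h)%g p.1, a (g * h)%g p.2) = (a g (a h p.1), a g (a h p.2)).
Proof. by rewrite !actM. Qed.

Definition diag_action : left_action G (Q * Q)%type :=
  @LeftAction G (Q * Q)%type (fun g p => (a g p.1, a g p.2))
    diag_act1 diag_actM.

Definition disc_gen (q : Q) (g : G) : Q * Q := (q, a g q).

Definition vertical (v : Q * Q) : Prop := exists q g, v = disc_gen q g.

Definition composable (v w : Q * Q) : Prop := vertical v /\ v.1 = w.1.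

(* Meaningful for [composable v w] only. For a free action the group element
   [g] with [v = disc_gen v.1 g] is unique: see [vcomp_disc_gen]. *)
Definition vcomp (v w : Q * Q) : Q * Q :=
  (w.1, a (xget 1%g [set g | v = disc_gen v.1 g]) w.2).

Lemma vcomp_disc_gen : free_action a -> forall q0 q1 g,
  vcomp (disc_gen q0 g) (q0, q1) = (q0, a g q1).
Proof.
move=> fa q0 q1 g; rewrite /vcomp /=; congr (_, a _ q1).
apply: xget_unique => //= h [/esym e].
have e1 : a (g^-1 * h)%g q0 = q0 by rewrite actM e -actM mulVg act1.
by rewrite -[h]mul1g -(mulgV g) -mulgA (fa _ _ e1) mulg1.
Qed.

Definition hor (Ad : Q * Q -> G) (p : Q * Q) : Q * Q :=
  vcomp (disc_gen p.1 (Ad p)^-1%g) p.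

Definition ver (Ad : Q * Q -> G) (p : Q * Q) : Q * Q := disc_gen p.1 (Ad p).

End DiscreteConnection.

(* Main.v *)
Require Import Defs.
From mathcomp Require Import all_boot all_order all_algebra.
From mathcomp Require Import all_classical all_reals topology normedtype derive.

(** Freeness makes the group element of a vertical pair unique, so composing with [disc_gen q0 g]
    just moves the second point by [g] ([vcomp_disc_gen]). Everything then reduces to group
    identities: [Ad] cancels its inverse, and conjugation by [g] matches the shift of base point. *)

Lemma horE (G : groupType) (Q : Type) (a : left_action G Q) (Ad : Q * Q -> G) :
  free_action a ->
  forall q0 q1, hor a Ad (q0, q1) = (q0, a (Ad (q0, q1))^-1%g q1).
Proof. by move=> a_free q0 q1; exact: vcomp_disc_gen. Qed.

Theorem proposition4p4 (R : realType) (m n : nat)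
    (G : lieGroupType R m) (Q : smoothManifoldType R n)
    (a : left_action G Q)
    (a_smooth : smooth_action a)
    (a_free : free_action a)
    (pi_submersion : proj_submersion a)
    (Ad : Q * Q -> G)
    (Ad_equivariant : forall (g : G) (q0 q1 : Q),
       Ad (a g q0, a g q1) = (g * Ad (q0, q1) * g^-1)%g)
    (Ad_disc_gen : forall (q : Q) (g : G), Ad (q, a g q) = g) :
  (forall q0 q1 : Q,
     composable a (ver a Ad (q0, q1)) (hor a Ad (q0, q1)) /\
     (q0, q1) = vcomp a (ver a Ad (q0, q1)) (hor a Ad (q0, q1))) /\
  (forall (g : G) (q0 q1 : Q),
     hor a Ad (a g q0, a g q1) = diag_action a g (hor a Ad (q0, q1)) /\
     ver a Ad (a g q0, a g q1) = diag_action a g (ver a Ad (q0, q1))).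
Proof.
split=> [q0 q1|g q0 q1].
  rewrite horE //; split; first by split=> //; exists q0, (Ad (q0, q1)).
  (* [hor] keeps the base point [q0], so the composition formula applies again. *)
  by rewrite vcomp_disc_gen // -actM mulgV act1.
split.
  (* With $A$ the value of [Ad] at [(q0, q1)], it remains to see $(gAg^{-1})^{-1}g = gA^{-1}$. *)
  rewrite !horE //= Ad_equivariant -!actM; congr (_, a _ q1).
  by rewrite !invgM invgK -!mulgA mulVg mulg1.
by rewrite /ver /disc_gen /= Ad_equivariant -!actM -!mulgA mulVg mulg1.
Qed.
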